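(* Let $n\ge3$, let $(\lambda_1,\lambda_2)\in\Lambda$, and let $(M^n,g)$ be a Riemannian manifold whose curvature operator $\mathcal{R}$ is $(\lambda_1,\lambda_2)$-nonnegative. Then the scalar curvature satisfies $\mathrm{Scal}(\mathcal{R})\ge0$, with equality (at a point) if and only if $\mathcal{R}=0$ (at that point).
   Context: For a Riemannian manifold $(M^n,g)$, $Rm(X,Y)Z=\nabla_X\nabla_YZ-\nabla_Y\nabla_XZ-\nabla_{[X,Y]}Z$, and the curvature operator $\mathcal{R}$ is the symmetric bilinear form (equivalently, self-adjoint endomorphism) on $\Lambda^2TM$ given by $\mathcal{R}(X\wedge Y,Z\wedge W)=2\langle Rm(X,Y)W,Z\rangle$, where $\Lambda^2T_xM$ carries the inner product for which $\{e_i\wedge e_j\}_{i<j}$ is orthonormal whenever $\{e_i\}$ is an orthonormal basis of $T_xM$. $\mathrm{Scal}(\mathcal{R})$ denotes the scalar curvature of $g$. Put $N=n(n-1)/2$ and let $\mu_1\le\mu_2\le\cdots\le\mu_N$ be the eigenvalues of $\mathcal{R}$ at a point (with multiplicity). Let $\Lambda=\{(x,y)\in[0,1]\times[0,1] : 0\le y\le x\le 1,\ 0<1-(x+y)y\le x\le 1\}$. For $(\lambda_1,\lambda_2)\in\Lambda$, $\mathcal{R}$ is called $(\lambda_1,\lambda_2)$-nonnegative if, at every point of $M$, $\mu_\alpha+\lambda_1\mu_\beta+\lambda_2\mu_\gamma\ge 0$ for all $1\le\alpha<\beta<\gamma\le N$ and $\lambda_1\mu_\alpha+(1-(\lambda_1+\lambda_2)\lambda_2)\mu_\beta\ge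 0$ for all $1\le\alpha<\beta\le N$. *)

(* Defs.v *)
From HB Require Import structures.
From mathcomp Require Import all_boot all_order all_algebra.
From mathcomp Require Import all_classical all_reals all_analysis.
Set Implicit Arguments.
Unset Strict Implicit.
Unset Printing Implicit Defensive.
Import Order.TTheory GRing.Theory Num.Theory.
Import numFieldNormedType.Exports.
Local Open Scope classical_set_scope.
Local Open Scope ring_scope.

(* C^k on an open set U, by iterated directional derivatives; k = oo below. *)
Fixpoint Ck_on (R : realType) (V W : normedModType R) (k : nat) (U : set V)
    (f : V -> W) : Prop :=
  (forall x, U x -> {for x, continuous f}) /\
  (if k is k'.+1 then
     forall v : V, (forall x, U x -> derivable f x v) /\
                   Ck_on k' U (fun x => 'D_v f x)
   else True).

Definition smooth_on (R : realType) (V W : normedModType R) (U : set V)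
    (f : V -> W) : Prop := forall k, Ck_on k U f.

(* A smooth n-manifold on the space M.  [chart_at p] is a distinguished chart
   around p: it says that the charts cover M, and it identifies T_pM with
   'rV[R]_n. Values of [phi i] off [dom i], and of [psi i] off its image, are
   irrelevant. *)
Record smooth_manifold (R : realType) (n : nat) (M : topologicalType) :=
  SmoothManifold {
    man_hausdorff : hausdorff_space M;
    man_second_countable : @second_countable M;
    chart : Type;
    dom : chart -> set M;
    phi : chart -> M -> 'rV[R]_n;
    psi : chart -> 'rV[R]_n -> M;
    chart_at : M -> chart;
    dom_chart_at : forall p, dom (chart_at p) p;
    dom_open : forall i, open (dom i);
    cod_open : forall i, open (phi i @` dom i);
    phiK : forall i p, dom i p -> psi i (phi i p) = p;
    phi_continuous : forall i p, dom i p -> {for p, continuous (phi i)};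
    psi_continuous : forall i x,
      (phi i @` dom i) x -> {for x, continuous (psi i)};
    transition_smooth : forall i j,
      smooth_on [set x | (phi i @` dom i) x /\ dom j (psi i x)]
                (phi j \o psi i)
  }.

Arguments dom {R n M} _ _.
Arguments phi {R n M} _ _ _.
Arguments psi {R n M} _ _ _.
Arguments chart_at {R n M} _ _.

(* Tangent vectors are row vectors; ['J f x] is the library's Jacobian, for
   which the differential of f at x sends v to v *m 'J f x. *)
Record riemannian_metric (R : realType) (n : nat) (M : topologicalType)
    (S : smooth_manifold R n M) := RiemannianMetric {
    metric : chart S -> 'rV[R]_n -> 'M[R]_n;
    metric_smooth : forall i, smooth_on (phi S i @` dom S i) (metric i);
    metric_symmetric : forall i x, (phi S i @` dom S i) x ->
      (metric i x)^T = metric i x;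
    metric_pos : forall i x, (phi S i @` dom S i) x ->
      forall v : 'rV[R]_n, v != 0 -> 0 < (v *m metric i x *m v^T) 0 0;
    metric_change : forall i j x,
      (phi S i @` dom S i) x -> dom S j (psi S i x) ->
      let tau := phi S j \o psi S i in
      metric i x = 'J tau x *m metric j (tau x) *m ('J tau x)^T
  }.

Section LocalGeometry.
Variables (R : realType) (n : nat) (G : 'rV[R]_n -> 'M[R]_n).
Implicit Types X Y Z : 'rV[R]_n -> 'rV[R]_n.

Definition coord_vec (i : 'I_n) : 'rV[R]_n := delta_mx 0 i.

Definition pd (i : 'I_n) (f : 'rV[R]_n -> R) (x : 'rV[R]_n) : R :=
  'D_(coord_vec i) f x.

(* Gamma_{ij}^k *)
Definition christoffel (x : 'rV[R]_n) (i j k : 'I_n) : R :=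
  2^-1 * \sum_(l < n) invmx (G x) k l *
    (pd i (fun y => G y j l) x + pd j (fun y => G y i l) x
     - pd l (fun y => G y i j) x).

(* The Levi-Civita connection and the Lie bracket, in coordinates. *)
Definition nabla X Y : 'rV[R]_n -> 'rV[R]_n := fun x =>
  'D_(X x) Y x
  + \row_k \sum_(i < n) \sum_(j < n) X x 0 i * Y x 0 j * christoffel x i j k.

Definition lie X Y : 'rV[R]_n -> 'rV[R]_n := fun x =>
  'D_(X x) Y x - 'D_(Y x) X x.

Definition Rm_field X Y Z : 'rV[R]_n -> 'rV[R]_n := fun x =>
  nabla X (nabla Y Z) x - nabla Y (nabla X Z) x - nabla (lie X Y) Z x.

End LocalGeometry.

Arguments coord_vec {R n} _.

Section Curvature.
Variables (R : realType) (n : nat) (M : topologicalType).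
Variables (S : smooth_manifold R n M) (g : riemannian_metric S) (p : M).

Definition metric_at : 'M[R]_n :=
  metric g (chart_at S p) (phi S (chart_at S p) p).

Definition inner (u v : 'rV[R]_n) : R := (u *m metric_at *m v^T) 0 0.

(* Rm is tensorial, so its value on tangent vectors at p is computed on their
   extensions with constant coefficients. *)
Definition Rm (u v w : 'rV[R]_n) : 'rV[R]_n :=
  Rm_field (metric g (chart_at S p)) (fun=> u) (fun=> v) (fun=> w)
           (phi S (chart_at S p) p).

Definition Ric (v w : 'rV[R]_n) : R :=
  \sum_(i < n) Rm (coord_vec i) v w 0 i.

Definition Scal : R :=
  \sum_(j < n) \sum_(k < n)
    invmx metric_at j k * Ric (coord_vec j) (coord_vec k).

(* The curvature operator as a bilinear form on decomposable bivectors: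
   [curvop x y z w] is R(x /\ y, z /\ w). *)
Definition curvop (x y z w : 'rV[R]_n) : R := 2 * inner (Rm x y w) z.

Definition curvop_zero : Prop := forall x y z w, curvop x y z w = 0.

(* The rows of E form an orthonormal basis of T_pM. *)
Definition orthonormal_frame (E : 'M[R]_n) : Prop :=
  forall a b, inner (row a E) (row b E) = (a == b)%:R.

(* Index set of the basis e_a /\ e_b, a < b, of the space of bivectors. *)
Notation wedge_idx := {ab : 'I_n * 'I_n | (ab.1 < ab.2)%N}.

Definition curvop_mx (E : 'M[R]_n) : 'M[R]_#|{: wedge_idx}| :=
  \matrix_(s, t)
    let ab := val (enum_val s) in let cd := val (enum_val t) in
    curvop (row ab.1 E) (row ab.2 E) (row cd.1 E) (row cd.2 E).

(* mu lists, in nondecreasing order and with multiplicity, the eigenvalues of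
   the curvature operator at p; they do not depend on the orthonormal frame. *)
Definition curvop_eigenvalues (mu : 'I_((n * n.-1)./2) -> R) : Prop :=
  (forall a b : 'I_((n * n.-1)./2), (a <= b)%N -> mu a <= mu b) /\
  exists E : 'M[R]_n, orthonormal_frame E /\
    char_poly (curvop_mx E) = \prod_a ('X - (mu a)%:P).

End Curvature.

Definition in_Lambda (R : realType) (x y : R) : Prop :=
  [/\ 0 <= x <= 1, 0 <= y <= 1, 0 <= y <= x & 0 < 1 - (x + y) * y <= x].

Definition lambda_nonnegative (R : realType) (n : nat) (M : topologicalType)
    (S : smooth_manifold R n M) (g : riemannian_metric S) (l1 l2 : R) : Prop :=
  forall (p : M) (mu : 'I_((n * n.-1)./2) -> R), curvop_eigenvalues g p mu ->
    (forall a b c : 'I_((n * n.-1)./2), (a < b)%N -> (b < c)%N ->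
       0 <= mu a + l1 * mu b + l2 * mu c) /\
    (forall a b : 'I_((n * n.-1)./2), (a < b)%N ->
       0 <= l1 * mu a + (1 - (l1 + l2) * l2) * mu b).

(* Main.v *)
(** In coordinates, differentiating the Koszul identity
    <Gamma(u, v), w> = (D_u g(v, w) + D_v g(u, w) - D_w g(u, v)) / 2 gives
    <Rm(u, v) w, z> = (D_u D_w g(v, z) - D_u D_z g(v, w) - D_v D_w g(u, z)
      + D_v D_z g(u, w)) / 2 - <Gamma(u, z), Gamma(v, w)> + <Gamma(v, z), Gamma(u, w)>,
    from which all algebraic symmetries of the curvature tensor can be read off, given the
    symmetry of second derivatives.  Hence the curvature operator is symmetric, its
    eigenvalues mu are real, and Scal is its trace, the sum of the mu's.

    Write L = 1 - (l1 + l2) l2, so 0 < L <= l1.  From l1 mu_1 + L mu_2 >= 0 one gets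
    mu_2 >= 0 and mu_1 + mu_2 >= 0.  As there are at least three eigenvalues,
    Scal >= mu_3 >= mu_2 >= 0, and if Scal = 0 then mu_2 = 0, hence mu_1 = 0 and all mu
    vanish, so that the operator, being diagonalizable, is zero. *)
From HB Require Import structures.
Require Import Defs.
From mathcomp Require Import all_boot all_order all_algebra.
From mathcomp Require Import spectral sesquilinear complex ring lra.
From mathcomp Require Import all_classical all_reals all_analysis.
Set Implicit Arguments.
Unset Strict Implicit.
Unset Printing Implicit Defensive.
Import Order.TTheory GRing.Theory Num.Theory.
Import numFieldNormedType.Exports.
Local Open Scope classical_set_scope.
Local Open Scope ring_scope.

(** * Directional derivatives of C^1 and C^2 functions *)

Section Calculus.
Variables (R : realType) (V : normedModType R).
Implicit Types f : V -> R.

Lemma line_growth_rate f (x u : V) (t : R) :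
  (fun h : R => h^-1 *: (((fun t => f (x + t *: u)) \o shift t) (h *: 1) - f (x + t *: u))) =
  (fun h : R => h^-1 *: ((f \o shift (x + t *: u)) (h *: u) - f (x + t *: u))).
Proof.
apply/funext => h /=; congr (_ *: (f _ - _)).
by rewrite [_ *: 1]mulr1 scalerDl addrCA.
Qed.

(** The two difference quotients are the same function of the increment, so one-variable calculus
    becomes available along lines. *)
Lemma is_derive_line f (x u : V) (t d : R) :
  is_derive (x + t *: u) u f d <-> is_derive t 1 (fun t => f (x + t *: u)) d.
Proof.
split=> -[dv dE].
  by apply: DeriveDef; [rewrite /derivable line_growth_rate|rewrite /derive line_growth_rate].
by apply: DeriveDef; [rewrite /derivable -line_growth_rate|rewrite /derive -line_growth_rate].
Qed.

Lemma MVT_line_gt0 f (x u : V) (s : R) : 0 < s ->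
  (forall t, 0 <= t <= s -> derivable f (x + t *: u) u) ->
  exists2 t, 0 <= t <= s & f (x + s *: u) - f x = s * 'D_u f (x + t *: u).
Proof.
move=> s0 df.
have dl t : 0 <= t <= s ->
    is_derive t 1 (fun t => f (x + t *: u)) ('D_u f (x + t *: u)).
  by move=> ts; apply/is_derive_line/derivableP/df.
have [t|t|t ts] := @MVT_segment R (fun t => f (x + t *: u)) (fun t => 'D_u f (x + t *: u)) 0 s (ltW s0).
- by rewrite in_itv/= => /andP[? ?]; apply: dl; rewrite !ltW.
- apply: derivable_within_continuous => {}t; rewrite in_itv/= => /dl.
  by case.
rewrite scale0r addr0 subr0 mulrC => E; exists t => //.
Qed.

Lemma MVT_line f (x u : V) (s : R) :
  (forall t, `|t| <= `|s| -> derivable f (x + t *: u) u) ->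
  exists2 t, `|t| <= `|s| & f (x + s *: u) - f x = s * 'D_u f (x + t *: u).
Proof.
move=> df; have [s0|s0|->] := ltrgt0P s.
- have [t|t /andP[t0 ts] E] := @MVT_line_gt0 f x u s s0.
    by move=> /andP[t0 ts]; apply: df; rewrite ger0_norm ?gtr0_norm.
  by exists t => //; rewrite ger0_norm.
(* For negative [s] the segment is traversed from its other end [x + s *: u], with length [- s]. *)
- have s0' : 0 < - s by rewrite oppr_gt0.
  have [t|t /andP[t0 ts] E] := @MVT_line_gt0 f (x + s *: u) u _ s0'.
    move=> /andP[t0 ts]; rewrite -addrA -scalerDl; apply: df.
    by rewrite (ltr0_norm s0) ler_norml; lra.
  move: E; rewrite -!addrA -!scalerDl subrr scale0r addr0 => E.
  exists (s + t).
    by rewrite ler_norml; lra.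
  by rewrite -opprB E mulNr opprK.
- by exists 0; rewrite ?normr0 // scale0r addr0 subrr mul0r.
Qed.

Lemma is_derive_dirZ f (x u : V) (c d : R) :
  is_derive x u f d -> is_derive x (c *: u) f (c * d).
Proof.
move=> fd.
suff : is_derive (x + (0 : R) *: (c *: u)) (c *: u) f (c * d).
  by rewrite scale0r addr0.
apply/is_derive_line.
have -> : (fun t => f (x + t *: (c *: u))) = (fun t => f (x + t *: u)) \o (fun t => t * c).
  by apply/funext => t /=; rewrite scalerA.
have h : is_derive (0 * c) 1 (fun t => f (x + t *: u)) d.
  by apply/is_derive_line; rewrite mul0r scale0r addr0.
rewrite mulrC; apply: is_derive1_comp.
by apply: is_derive_eq; rewrite scaler0 add0r [LHS]mulr1.
Qed.

(** Going from [x] to [x + h (u + v)] through [x + h u] splits the increment in two. The [u]-part is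
    the definition of the derivative at [x]; the mean value theorem turns the [v]-part into ['D_v f]
    at a nearby point, which converges by continuity. *)
Lemma is_derive_dirD f (x u v : V) : derivable f x u ->
  (\forall y \near x, derivable f y v) -> {for x, continuous (fun y => 'D_v f y)} ->
  is_derive x (u + v) f ('D_u f x + 'D_v f x).
Proof.
move=> fu fv fvc.
suff fuv : h^-1 *: ((f \o shift x) (h *: (u + v)) - f x) @[h --> 0^'] -->
    'D_u f x + 'D_v f x.
  by apply: DeriveDef; [exact: (cvgP _ fuv)|exact: (cvg_lim _ fuv)].
rewrite (addrC ('D_u f x)); under eq_fun => h.
  rewrite /= -(subrKA (f (h *: u + x))) scalerDr.
  over.
apply: cvgD; last exact: fu.
apply/cvgrPdist_le => e e0.
have /nbhs_ballP[d /= d0 dP] : \forall y \near x, derivable f y v /\ `|'D_v f x - 'D_v f y| <= e.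
  near=> y; split; near: y; first exact: fv.
  by move/cvgrPdist_le: fvc; apply.
(* The summand 1 keeps [K] positive when [u = v = 0]; then [|h| < d / K] keeps the whole segment in
   the ball of radius [d]. *)
pose K := `|u| + `|v| + 1.
have K0 : 0 < K by rewrite ltr_wpDl ?addr_ge0.
have near_h : \forall h \near (0 : R)^', h != 0 /\ `|h| < d / K.
  near=> h; split; near: h; first exact: nbhs_dnbhs_neq.
  by apply: dnbhs0_lt; rewrite divr_gt0.
near=> h.
have [h0 hd] : h != 0 /\ `|h| < d / K by near: h.
have inb t : `|t| <= `|h| -> ball x d (h *: u + x + t *: v).
  move=> th; rewrite -ball_normE /= addrAC opprD addrCA subrr addr0 normrN.
  rewrite ltr_pdivlMr // in hd; apply: le_lt_trans hd.
  rewrite /K mulrDr mulr1 mulrDr (le_trans (ler_normD _ _))// !normrZ -addrA lerD2l.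
  by rewrite (le_trans (ler_wpM2r _ th)) // lerDl.
have [t th] := @MVT_line f (h *: u + x) v h (fun t ht => (dP _ (inb t ht)).1).
have -> : h *: (u + v) + x = h *: u + x + h *: v by rewrite scalerDr addrAC.
move=> ->; rewrite [_ *: _]mulrA mulVf // mul1r.
by have [] := dP _ (inb _ th).
Unshelve. all: by end_near. Qed.

Lemma is_derive_shift_point f (a x u : V) :
  derivable f (x + a) u -> is_derive x u (fun y => f (y + a)) ('D_u f (x + a)).
Proof.
move=> df.
have E : (fun h : R => h^-1 *: (((fun y => f (y + a)) \o shift x) (h *: u) - f (x + a))) =
  (fun h : R => h^-1 *: ((f \o shift (x + a)) (h *: u) - f (x + a))).
  by apply/funext => h /=; rewrite addrA.
by apply: DeriveDef; [rewrite /derivable E|rewrite /derive E].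
Qed.

(** The mean value theorem is used twice: along [u] for the difference [f (y + s *: v) - f y], then
    along [v] for ['D_u f]. *)
Lemma second_difference_MVT f (x u v : V) (s : R) : 0 < s ->
  (forall a b, 0 <= a <= s -> 0 <= b <= s ->
     derivable f (x + a *: u + b *: v) u /\
     derivable (fun y => 'D_u f y) (x + a *: u + b *: v) v) ->
  exists a b, [/\ 0 <= a <= s, 0 <= b <= s &
    f (x + s *: u + s *: v) - f (x + s *: u) - (f (x + s *: v) - f x) =
    s * (s * 'D_v (fun y => 'D_u f y) (x + a *: u + b *: v))].
Proof.
move=> s0 df.
have ss : 0 <= s <= s by apply/andP; split=> //; exact: ltW.
have s00 : (0 : R) <= 0 <= s by rewrite lexx ltW.
pose g y := f (y + s *: v) - f y.
have dg a : 0 <= a <= s -> is_derive (x + a *: u) u g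
    ('D_u f (x + a *: u + s *: v) - 'D_u f (x + a *: u)).
  move=> a0.
  have [df1 _] := df a s a0 ss; have [df2 _] := df a 0 a0 s00.
  rewrite scale0r addr0 in df2.
  exact: (is_deriveB (is_derive_shift_point df1) (derivableP df2)).
have [a a0 aE] := @MVT_line_gt0 g x u s s0 (fun t ht => @ex_derive _ _ _ _ _ _ _ (dg t ht)).
have [b b0 bE] := @MVT_line_gt0 (fun y => 'D_u f y) (x + a *: u) v s s0 (fun b b0 => (df a b a0 b0).2).
exists a, b; split => //.
by rewrite -[LHS]/(g (x + s *: u) - g x) aE (@derive_val _ _ _ _ _ _ _ (dg a a0)) bE.
Qed.

Lemma eq_dist_le (a b : R) : (forall e, 0 < e -> `|a - b| <= e + e) -> a = b.
Proof.
move=> h; apply/eqP; rewrite -subr_eq0; apply: contraT => ab.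
have e0 : 0 < `|a - b| by rewrite normr_gt0.
have /h : 0 < `|a - b| / 3 by rewrite divr_gt0.
lra.
Qed.

Lemma dist_le_common (a b c d e : R) :
  `|a - c| <= e -> `|b - d| <= e -> c = d -> `|a - b| <= e + e.
Proof.
move=> ac bd cd; rewrite -(subrKA c) (le_trans (ler_normD _ _)) // lerD //.
by rewrite cd distrC.
Qed.

Lemma near_continuous2 (P : set V) (A B : V -> R) (x : V) (e : R) :
  (\near x, P x) -> {for x, continuous A} -> {for x, continuous B} -> 0 < e ->
  exists2 d : R, 0 < d &
    forall y, ball x d y -> [/\ P y, `|A x - A y| <= e & `|B x - B y| <= e].
Proof.
move=> nP /cvgrPdist_le cA /cvgrPdist_le cB e0.
have /nbhs_ballP[d /= d0 dP] : \forall y \near x,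
    [/\ P y, `|A x - A y| <= e & `|B x - B y| <= e].
  by apply: filterS3 nP (cA e e0) (cB e e0) => y ? ? ?; split.
by exists d.
Qed.

(** Schwarz's theorem. The second difference of [f] is symmetric in [u] and [v], so the two mixed
    derivatives agree at two possibly distinct points of any small parallelogram at [x]; continuity
    brings both values back to [x]. *)
Lemma derive_comm f (x u v : V) :
  (\forall y \near x, [/\ derivable f y u, derivable f y v,
     derivable (fun z => 'D_u f z) y v & derivable (fun z => 'D_v f z) y u]) ->
  {for x, continuous (fun y => 'D_v (fun z => 'D_u f z) y)} ->
  {for x, continuous (fun y => 'D_u (fun z => 'D_v f z) y)} ->
  'D_v (fun z => 'D_u f z) x = 'D_u (fun z => 'D_v f z) x.
Proof.
pose A y := 'D_v (fun z => 'D_u f z) y; pose B y := 'D_u (fun z => 'D_v f z) y.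
move=> df cA cB; rewrite -[LHS]/(A x) -[RHS]/(B x).
apply: eq_dist_le => e e0.
have [d d0 dP] := near_continuous2 df cA cB e0.
pose K := `|u| + `|v| + 1.
have K0 : 0 < K by rewrite ltr_wpDl ?addr_ge0.
(* This side length keeps the closed parallelogram spanned by [s *: u] and [s *: v] inside the ball
   of radius [d]. *)
pose s := d / K / 2.
have s0 : 0 < s by rewrite !divr_gt0.
have sK : s * (`|u| + `|v|) < d.
  have -> : d = s * K + s * K by rewrite /s; field; rewrite gt_eqF.
  have : 0 <= s * (`|u| + `|v|) by rewrite mulr_ge0 ?addr_ge0 // ltW.
  by rewrite /K [s * (_ + 1)]mulrDr mulr1; lra.
have inb a b : 0 <= a <= s -> 0 <= b <= s -> ball x d (x + a *: u + b *: v).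
  move=> /andP[a0 as_] /andP[b0 bs].
  rewrite -ball_normE /= -addrA opprD addNKr normrN; apply: le_lt_trans sK.
  by rewrite mulrDr (le_trans (ler_normD _ _))// !normrZ !ger0_norm // lerD // ler_wpM2r.
have [a [b [a0 b0 E1]]] := @second_difference_MVT f x u v s s0
  (fun a b a0 b0 => let: And3 (And4 p _ q _) _ _ := dP _ (inb a b a0 b0) in conj p q).
have inb' b' a' : 0 <= b' <= s -> 0 <= a' <= s -> ball x d (x + b' *: v + a' *: u).
  by move=> *; rewrite addrAC; exact: inb.
have [b' [a' [b'0 a'0 E2]]] := @second_difference_MVT f x v u s s0
  (fun b a b0 a0 => let: And3 (And4 _ p _ q) _ _ := dP _ (inb' b a b0 a0) in conj p q).
have [_ hA _] := dP _ (inb _ _ a0 b0).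
have [_ _ hB] := dP _ (inb' _ _ b'0 a'0).
have sn0 : s != 0 by rewrite gt_eqF.
have EAB : A (x + a *: u + b *: v) = B (x + b' *: v + a' *: u).
  apply: (mulfI sn0); apply: (mulfI sn0).
  refine (etrans (esym E1) (etrans _ E2)).
  rewrite (addrAC x (s *: v)); ring.
exact: (dist_le_common hA hB EAB).
Qed.

End Calculus.

(** * C^k functions on an open set *)

Section SmoothFunctions.
Variables (R : realType) (V W : normedModType R).
Implicit Types U : set V.

(** Continuity and derivatives at a point of [U] see only a neighbourhood, which can be taken inside
    [U]; induction on [k] passes this to iterated derivatives. *)
Lemma Ck_on_eq k U (f g : V -> W) : open U -> (forall x, U x -> f x = g x) ->
  Ck_on k U f -> Ck_on k U g.
Proof.
move=> Uo; elim: k f g => [|k IHk] f g fg /= [fc fd].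
  split=> // x Ux; have fgx : \near x, f x = g x.
    by apply: filterS (open_nbhs_nbhs (conj Uo Ux)) => y /fg.
  rewrite /prop_for /continuous_at -(fg x Ux).
  exact: cvg_trans (near_eq_cvg fgx) (fc x Ux).
have fgn x : U x -> \near x, f x = g x.
  by move=> Ux; apply: filterS (open_nbhs_nbhs (conj Uo Ux)) => y /fg.
split.
  move=> x Ux; rewrite /prop_for /continuous_at -(fg x Ux).
  exact: cvg_trans (near_eq_cvg (fgn x Ux)) (fc x Ux).
move=> v; have [fv fk] := fd v; split.
  by move=> x Ux; apply: near_eq_derivable (fgn x Ux) (fv x Ux).
by apply: IHk fk => x Ux; apply: near_eq_derive; exact: fgn.
Qed.

Lemma Ck_on_derivable k U (f : V -> W) x v : Ck_on k.+1 U f -> U x -> derivable f x v.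
Proof. by move=> [_ /(_ v)[h _]]; exact: h. Qed.

Lemma Ck_on_derive k U (f : V -> W) v : Ck_on k.+1 U f -> Ck_on k U (fun y => 'D_v f y).
Proof. by move=> [_ /(_ v)[]]. Qed.

Lemma Ck_on_continuous k U (f : V -> W) x : Ck_on k U f -> U x -> {for x, continuous f}.
Proof. by case: k => [|k] [h _] Ux; exact: h. Qed.

End SmoothFunctions.

Section CkScalar.
Variables (R : realType) (V : normedModType R) (U : set V) (f : V -> R) (x : V).
Hypotheses (Uo : open U) (Ux : U x).

Lemma Ck_on_deriveD (u v : V) : Ck_on 1 U f -> 'D_(u + v) f x = 'D_u f x + 'D_v f x.
Proof.
move=> f1; apply: derive_val; apply: is_derive_dirD.
- exact: Ck_on_derivable f1 Ux.
- apply: filterS (open_nbhs_nbhs (conj Uo Ux)) => y Uy.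
  exact: Ck_on_derivable f1 Uy.
- exact: Ck_on_continuous (Ck_on_derive v f1) Ux.
Qed.

Lemma Ck_on_deriveZ (c : R) (u : V) : Ck_on 1 U f -> 'D_(c *: u) f x = c * 'D_u f x.
Proof.
move=> f1; apply: derive_val; apply/is_derive_dirZ/derivableP.
exact: Ck_on_derivable f1 Ux.
Qed.

Lemma Ck_on_derive_comm (u v : V) : Ck_on 2 U f ->
  'D_v (fun y => 'D_u f y) x = 'D_u (fun y => 'D_v f y) x.
Proof.
move=> f2; apply: derive_comm.
- apply: filterS (open_nbhs_nbhs (conj Uo Ux)) => y Uy; split.
  + exact: Ck_on_derivable f2 Uy.
  + exact: Ck_on_derivable f2 Uy.
  + exact: Ck_on_derivable (Ck_on_derive u f2) Uy.
  + exact: Ck_on_derivable (Ck_on_derive v f2) Uy.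
- exact: Ck_on_continuous (Ck_on_derive v (Ck_on_derive u f2)) Ux.
- exact: Ck_on_continuous (Ck_on_derive u (Ck_on_derive v f2)) Ux.
Qed.

End CkScalar.

(** * Derivatives of bilinear forms and of inverse matrices *)

Section MatrixValued.
Variables (R : realType) (V : normedModType R) (n : nat).
Implicit Types (F : V -> 'rV[R]_n) (G : V -> 'M[R]_n).

Lemma formE (u v : 'rV[R]_n) (A : 'M[R]_n) :
  (u *m A *m v^T) 0 0 = \sum_(j < n) \sum_(i < n) u 0 i * A i j * v 0 j.
Proof.
rewrite mxE; apply: eq_bigr => j _; rewrite !mxE mulr_suml.
by apply: eq_bigr => i _.
Qed.

(** The product rule, taken entry by entry; [z] is constant and contributes no term. *)
Lemma is_derive_form F G (x v : V) (z : 'rV[R]_n) :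
  derivable F x v -> derivable G x v ->
  is_derive x v (fun y => (F y *m G y *m z^T) 0 0)
    (('D_v F x *m G x *m z^T) 0 0 + (F x *m 'D_v G x *m z^T) 0 0).
Proof.
move=> dF dG.
have -> : (fun y => (F y *m G y *m z^T) 0 0) =
    \sum_(j < n) \sum_(i < n) (fun y => F y 0 i * G y i j * z 0 j).
  apply/funext => y; rewrite formE fct_sumE; apply: eq_bigr => j _.
  by rewrite fct_sumE.
rewrite !formE -big_split /=; apply: is_derive_sum => j.
rewrite -big_split /=; apply: is_derive_sum => i.
have dFi : is_derive x v (fun y => F y 0 i) ('D_v F x 0 i).
  by rewrite derive_mx // mxE; apply/derivableP; exact: ((derivable_mxP _ _ _).1 dF).
have dGi : is_derive x v (fun y => G y i j) ('D_v G x i j).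
  by rewrite derive_mx // mxE; apply/derivableP; exact: ((derivable_mxP _ _ _).1 dG).
have dM := is_deriveM (is_deriveM dFi dGi) (is_derive_cst (z 0 j) x v).
apply: (@is_derive_eq _ _ _ _ _ _ _ _ dM); rewrite scaler0 add0r /= /GRing.scale /=; ring.
Qed.

Lemma form_continuous G (u v : 'rV[R]_n) (x : V) : {for x, continuous G} ->
  {for x, continuous (fun y => (u *m G y *m v^T) 0 0)}.
Proof.
move=> Gc; rewrite /prop_for /continuous_at formE.
under eq_fun => y do rewrite formE.
apply: cvg_big => [|j _]; first exact: add_continuous.
apply: cvg_big => [|i _]; first exact: add_continuous.
apply: cvgMr_tmp; apply: cvgMl_tmp.
exact: (cvg_comp _ _ Gc (@coord_continuous R n n i j _)).
Qed.

(** For constant [u] and [v], differentiating the form along [w] gives the form of ['D_w G], so the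
    induction on [k] runs over all [G]. *)
Lemma Ck_on_form k (U : set V) G (u v : 'rV[R]_n) : open U -> Ck_on k U G ->
  Ck_on k U (fun y => (u *m G y *m v^T) 0 0).
Proof.
move=> Uo; elim: k G => [|k IHk] G /= [Gc Gd].
  by split=> // x Ux; exact: form_continuous (Gc x Ux).
split; first by move=> x Ux; exact: form_continuous (Gc x Ux).
move=> w; have [Gw Gk] := Gd w; split.
  move=> x Ux.
  by have [] := is_derive_form v (derivable_cst u x w) (Gw x Ux).
apply: Ck_on_eq Uo _ (IHk _ Gk) => x Ux.
have [_ ->] := is_derive_form v (derivable_cst u x w) (Gw x Ux).
by rewrite derive_cst !mul0mx [X in X + _]mxE add0r.
Qed.

Lemma derivable_bigsum (I : Type) (r : seq I) (P : pred I) (h : I -> V -> R) (x v : V) :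
  (forall i, derivable (h i) x v) -> derivable (fun y => \sum_(i <- r | P i) h i y) x v.
Proof.
move=> dh; elim: r => [|i r IHr].
  by under eq_fun do rewrite big_nil; exact: derivable_cst.
under eq_fun do rewrite big_cons.
by case: (P i); [exact: (derivableD (dh i) IHr)|exact: IHr].
Qed.

Lemma derivable_bigprod (I : Type) (r : seq I) (P : pred I) (h : I -> V -> R) (x v : V) :
  (forall i, derivable (h i) x v) -> derivable (fun y => \prod_(i <- r | P i) h i y) x v.
Proof.
move=> dh; elim: r => [|i r IHr].
  by under eq_fun do rewrite big_nil; exact: derivable_cst.
under eq_fun do rewrite big_cons.
by case: (P i); [exact: (derivableM (dh i) IHr)|exact: IHr].
Qed.

Lemma derivable_mulf (f g : V -> R) (x v : V) : derivable f x v -> derivable g x v ->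
  derivable (fun y => f y * g y) x v.
Proof. exact: derivableM. Qed.

Lemma derivable_cmul (c : R) (g : V -> R) (x v : V) : derivable g x v ->
  derivable (fun y => c * g y) x v.
Proof. exact: (derivableM (derivable_cst c x v)). Qed.

Lemma derivable_det (m : nat) (H : V -> 'M[R]_m) (x v : V) :
  (forall i j, derivable (fun y => H y i j) x v) -> derivable (fun y => \det (H y)) x v.
Proof.
move=> dH; rewrite /determinant; apply: derivable_bigsum => s.
apply: derivable_cmul.
exact: derivable_bigprod.
Qed.

(** By Cramer's rule the inverse is the adjugate over the determinant, both polynomial in the
    entries. *)
Lemma derivable_invmx (H : V -> 'M[R]_n) (x v : V) : (\near x, H x \in unitmx) ->
  derivable H x v -> derivable (fun y => invmx (H y)) x v.
Proof.
move=> Hu /derivable_mxP dH.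
(* [invmx] returns its argument on singular matrices, so Cramer's formula is used only near [x]. *)
apply: (@near_eq_derivable _ _ _ (fun y => (\det (H y))^-1 *: \adj (H y))).
  by apply: filterS Hu => y Hy; rewrite /invmx Hy.
apply/derivable_mxP => i j.
have -> : (fun y => ((\det (H y))^-1 *: \adj (H y)) i j) =
    (fun y => (\det (H y))^-1 * ((-1) ^+ (j + i) * \det (row' j (col' i (H y))))).
  by apply/funext => y; rewrite !mxE.
apply: derivable_mulf.
  apply: derivableV; last exact: derivable_det.
  by have := nbhs_singleton Hu; rewrite unitmxE unitfE.
apply: derivable_cmul.
apply: derivable_det => a b; under eq_fun do rewrite !mxE; exact: dH.
Qed.

Lemma scalar0 (f : 'rV[R]_n -> R) : scalar f -> f 0 = 0.
Proof. by move=> fL; apply: (addrI (f 0)); rewrite addr0 -{1}[f 0]mul1r -fL scaler0 addr0. Qed.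

Lemma scalar_expand (f : 'rV[R]_n -> R) : scalar f ->
  forall u, f u = \sum_(i < n) u 0 i * f (coord_vec i).
Proof.
move=> fL u.
have f0 := scalar0 fL.
have fD a b : f (a + b) = f a + f b by rewrite -{1}[a]scale1r fL mul1r.
have fZ c a : f (c *: a) = c * f a by rewrite -[c *: a]addr0 fL f0 addr0.
rewrite [in LHS](row_sum_delta u) (big_morph f fD f0).
by apply: eq_bigr => i _; rewrite fZ.
Qed.

Lemma scalar_form (A : 'M[R]_n) (b : 'rV[R]_n) : scalar (fun a : 'rV[R]_n => (a *m A *m b^T) 0 0).
Proof. by move=> c a a'; rewrite /= !mulmxDl -!scalemxAl !mxE. Qed.

Lemma form_coord (A : 'M[R]_n) i j : (coord_vec i *m A *m (coord_vec j)^T) 0 0 = A i j.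
Proof. by rewrite /coord_vec -rowE trmx_delta -colE !mxE. Qed.

Lemma form_tr (A : 'M[R]_n) (a b : 'rV[R]_n) : A^T = A ->
  (a *m A *m b^T) 0 0 = (b *m A *m a^T) 0 0.
Proof.
move=> AT; rewrite -[in RHS]AT -[in RHS](trmxK b) -trmx_mul -trmx_mul [RHS]mxE.
by rewrite mulmxA.
Qed.

End MatrixValued.

(** * The Riemann tensor in a chart *)

Section LocalRiemann.
Variables (R : realType) (n : nat) (U : set 'rV[R]_n) (G : 'rV[R]_n -> 'M[R]_n).
Hypotheses (Uo : open U) (Gs : smooth_on U G).
Hypothesis GT : forall x, U x -> (G x)^T = G x.
Hypothesis Gp : forall x, U x -> forall v : 'rV[R]_n, v != 0 -> 0 < (v *m G x *m v^T) 0 0.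
Implicit Types a b u v w x y z : 'rV[R]_n.

Local Notation ip y a b := ((a *m G y *m b^T) 0 0).

Lemma near_domain x (P : set 'rV[R]_n) : U x -> (forall y, U y -> P y) -> \near x, P x.
Proof. by move=> Ux UP; apply: filterS (open_nbhs_nbhs (conj Uo Ux)). Qed.

(** With [a] and [b] constant in the chart, this is the term D_w g(a, b) of the Koszul identity. *)
Definition metric_deriv w a b : 'rV[R]_n -> R := fun y => 'D_w (fun y => ip y a b) y.

Local Ltac ring_atoms :=
  repeat match goal with
  | |- context [metric_deriv ?a ?b ?c ?d] => generalize (metric_deriv a b c d)
  | |- context [fun_of_matrix ?M ?i ?j] => generalize (fun_of_matrix M i j)
  end; intros; ring.

(* The Koszul expression of <Gamma(u, v), w>; see [ip_christoffel_vec]. *)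
Definition koszul u v w y :=
  2^-1 * (metric_deriv u v w y + metric_deriv v u w y - metric_deriv w u v y).

(** Gamma(u, v), that is, the covariant derivative along [u] of the constant field [v]. *)
Definition christoffel_vec u v y : 'rV[R]_n :=
  \row_k \sum_(i < n) \sum_(j < n) u 0 i * v 0 j * christoffel G y i j k.

Lemma Ck_on_ip k a b : Ck_on k U (fun y => ip y a b).
Proof. exact: Ck_on_form. Qed.

Lemma Ck_on_metric_deriv k w a b : Ck_on k U (metric_deriv w a b).
Proof. exact: (Ck_on_derive w (Ck_on_ip k.+1 a b)). Qed.

Lemma derivable_G w y : U y -> derivable G y w.
Proof. exact: Ck_on_derivable (Gs 1). Qed.

Lemma metric_derivE w a b y : U y -> metric_deriv w a b y = (a *m 'D_w G y *m b^T) 0 0.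
Proof.
move=> Uy.
have [_ E] := is_derive_form b (derivable_cst a y w) (derivable_G Uy).
by rewrite /metric_deriv E derive_cst !mul0mx [X in X + _]mxE add0r.
Qed.

Lemma ipC a b y : U y -> ip y a b = ip y b a.
Proof. by move=> Uy; apply/form_tr/GT. Qed.

Lemma metric_derivC w a b y : U y -> metric_deriv w a b y = metric_deriv w b a y.
Proof.
by move=> Uy; apply: near_eq_derive; apply: near_domain Uy _ => z Uz; exact: ipC.
Qed.

Lemma metric_deriv_scalarm w b y : U y -> scalar (fun a => metric_deriv w a b y).
Proof. by move=> Uy c a a'; rewrite !metric_derivE //; exact: scalar_form. Qed.

Lemma metric_deriv_scalarr w a y : U y -> scalar (fun b => metric_deriv w a b y).
Proof.
by move=> Uy c b b'; rewrite ![metric_deriv _ a _ _]metric_derivC //; exact: metric_deriv_scalarm.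
Qed.

(** Linearity in the direction of differentiation is not formal; it rests on the metric being
    C^1. *)
Lemma metric_deriv_scalarl a b y : U y -> scalar (fun w => metric_deriv w a b y).
Proof.
move=> Uy c w w'; rewrite /metric_deriv (Ck_on_deriveD Uo Uy); last exact: Ck_on_ip.
by rewrite (Ck_on_deriveZ Uy) //; exact: Ck_on_ip.
Qed.

Lemma koszul_scalar1 v w y : U y -> scalar (fun u => koszul u v w y).
Proof.
move=> Uy c u u'; rewrite /koszul (metric_deriv_scalarl _ _ Uy).
rewrite !(metric_deriv_scalarm _ _ Uy).
by ring_atoms.
Qed.

Lemma koszulC u v w y : U y -> koszul u v w y = koszul v u w y.
Proof. by move=> Uy; rewrite /koszul (metric_derivC w u v Uy) (addrC (metric_deriv u _ _ _)). Qed.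

Lemma koszul_scalar2 u w y : U y -> scalar (fun v => koszul u v w y).
Proof. by move=> Uy c v v'; rewrite ![koszul u _ _ _]koszulC //; exact: koszul_scalar1. Qed.

Lemma koszul_scalar3 u v y : U y -> scalar (fun w => koszul u v w y).
Proof.
move=> Uy c w w'; rewrite /koszul !(metric_deriv_scalarr _ _ Uy) (metric_deriv_scalarl _ _ Uy).
by ring_atoms.
Qed.

(** A kernel vector would have length zero, against positive definiteness. *)
Lemma G_unit y : U y -> G y \in unitmx.
Proof.
move=> Uy; rewrite -row_free_unit -kermx_eq0; apply/rowV0P => v /sub_kermxP vG.
by apply/eqP; apply: contraT => /(Gp Uy); rewrite vG mul0mx mxE ltxx.
Qed.

Lemma christoffelE i j k y : U y -> christoffel G y i j k =
  \sum_(l < n) koszul (coord_vec i) (coord_vec j) (coord_vec l) y * invmx (G y) l k.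
Proof.
move=> Uy; rewrite /christoffel mulr_sumr; apply: eq_bigr => l _.
have pdE p q r : pd p (fun z => G z q r) y = metric_deriv (coord_vec p) (coord_vec q) (coord_vec r) y.
  by rewrite /pd /metric_deriv; congr ('D_ _ _ _); apply/funext => z; rewrite form_coord.
(* Symmetry of the inverse metric exchanges [k] and [l], which gives the sum the shape of a matrix
   product. *)
rewrite !pdE /koszul -[in invmx _ k l](GT Uy) -trmx_inv mxE; ring.
Qed.

Lemma christoffel_vecE u v y : U y ->
  christoffel_vec u v y = (\row_l koszul u v (coord_vec l) y) *m invmx (G y).
Proof.
move=> Uy; apply/rowP => k; rewrite !mxE.
under [RHS]eq_bigr => l _.
  rewrite mxE (scalar_expand (koszul_scalar1 v _ Uy)) mulr_suml.
  under eq_bigr => i _ do rewrite (scalar_expand (koszul_scalar2 _ _ Uy)) mulr_sumr mulr_suml.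
  over.
rewrite [RHS]exchange_big /=; apply: eq_bigr => i _.
rewrite [RHS]exchange_big /=; apply: eq_bigr => j _.
rewrite christoffelE // mulr_sumr; apply: eq_bigr => l _; ring.
Qed.

(** Pairing with the metric cancels the inverse metric in Gamma; later computations use Gamma
    through this identity. *)
Lemma ip_christoffel_vec u v w y : U y -> ip y (christoffel_vec u v y) w = koszul u v w y.
Proof.
move=> Uy; rewrite christoffel_vecE // -mulmxA mulmxA mulmxKV ?G_unit // mxE.
rewrite (scalar_expand (koszul_scalar3 u v Uy)); apply: eq_bigr => l _.
by rewrite !mxE mulrC.
Qed.

Lemma ip_inj a b y : U y -> (forall z, ip y a z = ip y b z) -> a = b.
Proof.
move=> Uy ab; apply/eqP; rewrite -subr_eq0; apply: contraT => /(Gp Uy).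
by rewrite mulmxBl mulmxBl mxE [in X in _ + X]mxE ab subrr ltxx.
Qed.

Lemma christoffel_vecC u v y : U y -> christoffel_vec u v y = christoffel_vec v u y.
Proof. by move=> Uy; apply: (ip_inj Uy) => z; rewrite !ip_christoffel_vec // koszulC. Qed.

(** Only existence of the derivative comes from the formula with the inverse metric; its value is
    found in [ip_derive_christoffel_vec]. *)
Lemma derivable_christoffel_vec u v y w : U y -> derivable (christoffel_vec u v) y w.
Proof.
move=> Uy.
apply: (@near_eq_derivable _ _ _ (fun y => (\row_l koszul u v (coord_vec l) y) *m invmx (G y))).
  by apply: near_domain Uy _ => z Uz; rewrite christoffel_vecE.
apply/derivable_mxP => i k; under eq_fun do rewrite mxE.
apply: derivable_bigsum => l; apply: derivable_mulf.
  under eq_fun do rewrite mxE.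
  have dd a b c : derivable (metric_deriv a b c) y w.
    exact: Ck_on_derivable (Ck_on_metric_deriv 1 a b c) Uy.
  apply: derivable_cmul.
  exact: (derivableB (derivableD (dd _ _ _) (dd _ _ _)) (dd _ _ _)).
apply: (derivable_mxP _ _ _).1; apply: derivable_invmx.
  by apply: near_domain Uy _ => z; exact: G_unit.
exact: derivable_G.
Qed.

Definition metric_deriv2 u v a b x := 'D_u (metric_deriv v a b) x.

Lemma metric_deriv2C1 u v a b x : U x -> metric_deriv2 u v a b x = metric_deriv2 v u a b x.
Proof. by move=> Ux; apply: (Ck_on_derive_comm Uo Ux); exact: Ck_on_ip. Qed.

Lemma metric_deriv2C2 u v a b x : U x -> metric_deriv2 u v a b x = metric_deriv2 u v b a x.
Proof.
by move=> Ux; apply: near_eq_derive; apply: near_domain Ux _ => z Uz; exact: metric_derivC.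
Qed.

Lemma derive_koszul t u v w x : U x -> 'D_t (koszul u v w) x =
  2^-1 * (metric_deriv2 t u v w x + metric_deriv2 t v u w x - metric_deriv2 t w u v x).
Proof.
move=> Ux; apply: derive_val.
have dd a b c : is_derive x t (metric_deriv a b c) (metric_deriv2 t a b c x).
  by apply/derivableP; exact: Ck_on_derivable (Ck_on_metric_deriv 1 a b c) Ux.
exact: (is_deriveZ 2^-1 (is_deriveB (is_deriveD (dd u v w) (dd v u w)) (dd w u v))).
Qed.

(** Differentiate both sides of [ip_christoffel_vec]; the product rule leaves the term in which [G]
    is differentiated. *)
Lemma ip_derive_christoffel_vec t u v z x : U x ->
  ip x ('D_t (christoffel_vec u v) x) z =
    'D_t (koszul u v z) x - metric_deriv t (christoffel_vec u v x) z x.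
Proof.
move=> Ux.
have [_ E] := is_derive_form z (@derivable_christoffel_vec u v x t Ux) (derivable_G Ux).
rewrite metric_derivE //; apply/eqP; rewrite eq_sym subr_eq -E; apply/eqP.
by apply: near_eq_derive; apply: near_domain Ux _ => y Uy; rewrite ip_christoffel_vec.
Qed.

(** Constant fields commute, so the bracket term drops out, and their covariant derivatives are
    Gamma's. *)
Lemma Rm_fieldE u v w x : Rm_field G (fun=> u) (fun=> v) (fun=> w) x =
  ('D_u (christoffel_vec v w) x + christoffel_vec u (christoffel_vec v w x) x) -
  ('D_v (christoffel_vec u w) x + christoffel_vec v (christoffel_vec u w x) x).
Proof.
have nE a b : nabla G (fun=> a) (fun=> b) = christoffel_vec a b.
  by apply/funext => y; rewrite /nabla derive_cst add0r.
rewrite /Rm_field !nE.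
have -> : lie (fun=> u) (fun=> v) = fun=> 0.
  by apply/funext => y; rewrite /lie !derive_cst subr0.
rewrite nE (_ : christoffel_vec 0 w x = 0) ?subr0 //.
by apply/rowP => k; rewrite !mxE big1 // => i _; rewrite big1 // => j _; rewrite mxE !mul0r.
Qed.

Definition riem u v w z x := ip x (Rm_field G (fun=> u) (fun=> v) (fun=> w) x) z.

Local Ltac curvature_ring :=
  repeat match goal with
  | |- context [metric_deriv2 ?a ?b ?c ?d ?e] => generalize (metric_deriv2 a b c d e)
  | |- context [fun_of_matrix ?M ?i ?j] => generalize (fun_of_matrix M i j)
  | |- context [riem ?a ?b ?c ?d ?e] => generalize (riem a b c d e)
  end; intros; ring.

Lemma riemE u v w z x : U x -> riem u v w z x =
  2^-1 * (metric_deriv2 u w v z x - metric_deriv2 u z v w x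
    - metric_deriv2 v w u z x + metric_deriv2 v z u w x)
  - ip x (christoffel_vec u z x) (christoffel_vec v w x)
  + ip x (christoffel_vec v z x) (christoffel_vec u w x).
Proof.
move=> Ux.
(* Metric compatibility: D_a g(Gamma(b, c), z) minus the Koszul value of <Gamma(a, Gamma(b, c)), z>
   is the Koszul value of <Gamma(a, z), Gamma(b, c)>. *)
have half a b c : ip x ('D_a (christoffel_vec b c) x + christoffel_vec a (christoffel_vec b c x) x) z =
   'D_a (koszul b c z) x - ip x (christoffel_vec a z x) (christoffel_vec b c x).
  rewrite !mulmxDl mxE ip_derive_christoffel_vec // !ip_christoffel_vec // /koszul.
  rewrite (metric_derivC a z _ Ux).
  generalize ('D_a (koszul b c z) x) (metric_deriv a z (christoffel_vec b c x) x)
    (metric_deriv (christoffel_vec b c x) a z x) (metric_deriv z a (christoffel_vec b c x) x).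
  by intros; field.
rewrite /riem Rm_fieldE mulmxBl mulmxBl mxE [in X in _ + X]mxE !half !derive_koszul //.
(* The terms D_u D_v g(w, z) and D_v D_u g(w, z) of the two halves now cancel. *)
rewrite (metric_deriv2C1 v u) //.
curvature_ring.
Qed.

Lemma riem_scalar4 u v w x : U x -> scalar (fun z => riem u v w z x).
Proof.
by move=> Ux c z z'; rewrite /riem ![ip x (Rm_field _ _ _ _ _) _]ipC //; exact: scalar_form.
Qed.

(* Keeps unification and [ring] from unfolding limits when comparing atoms. *)
Local Opaque christoffel_vec metric_deriv2 riem.

Lemma riem_antisym12 u v w z x : U x -> riem u v w z x = - riem v u w z x.
Proof. by move=> Ux; rewrite !riemE //; curvature_ring. Qed.

Lemma riem_antisym34 u v w z x : U x -> riem u v w z x = - riem u v z w x.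
Proof.
move=> Ux; rewrite !riemE // (ipC (christoffel_vec v w x)) //.
rewrite (ipC (christoffel_vec u w x)) //; curvature_ring.
Qed.

(** After [riemE] the two sides differ only in the order of derivatives, the order of metric
    arguments and the order of the arguments of Gamma; the rewrites bring these to a common
    order. *)
Lemma riem_pair u v w z x : U x -> riem u v w z x = riem w z u v x.
Proof.
move=> Ux; rewrite !(riemE _ _ _ _ Ux).
rewrite (metric_deriv2C1 w u _ _ Ux) (metric_deriv2C1 w v _ _ Ux).
rewrite (metric_deriv2C1 z u _ _ Ux) (metric_deriv2C1 z v _ _ Ux).
rewrite (metric_deriv2C2 _ _ z v Ux) (metric_deriv2C2 _ _ z u Ux).
rewrite (metric_deriv2C2 _ _ w v Ux) (metric_deriv2C2 _ _ w u Ux).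
rewrite (christoffel_vecC w v Ux) (christoffel_vecC w u Ux) (christoffel_vecC z u Ux).
rewrite (christoffel_vecC z v Ux) (ipC (christoffel_vec v w x) _ Ux); curvature_ring.
Qed.

(** Linearity is immediate only in the last slot, as the others are differentiated through Gamma;
    the symmetries carry it to the third slot, then to the first two. *)
Lemma riem_scalar3 u v z x : U x -> scalar (fun w => riem u v w z x).
Proof.
move=> Ux c w w'; rewrite ![riem u v _ z x](riem_antisym34 _ _ _ _ Ux).
by rewrite (riem_scalar4 _ _ _ Ux); curvature_ring.
Qed.

Lemma riem_scalar1 v w z x : U x -> scalar (fun u => riem u v w z x).
Proof.
by move=> Ux c u u'; rewrite ![riem _ v w z x](riem_pair _ _ _ _ Ux) (riem_scalar3 _ _ _ Ux).
Qed.

Lemma riem_scalar2 u w z x : U x -> scalar (fun v => riem u v w z x).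
Proof.
by move=> Ux c v v'; rewrite ![riem u _ w z x](riem_pair _ _ _ _ Ux) (riem_scalar4 _ _ _ Ux).
Qed.

End LocalRiemann.

(** * Symmetric matrices and orthonormal frames *)

(** Scalar matrices commute with [P], so the characteristic matrix is conjugated as well and its
    determinant is unchanged. *)
Lemma char_poly_conj (F : comUnitRingType) n (P A : 'M[F]_n) : P \in unitmx ->
  char_poly (invmx P *m A *m P) = char_poly A.
Proof.
move=> Pu; rewrite /char_poly /char_poly_mx.
have PP : map_mx polyC (invmx P) *m map_mx polyC P = 1%:M.
  by rewrite -map_mxM mulVmx // map_mx1.
have -> : 'X%:M - map_mx polyC (invmx P *m A *m P) =
  map_mx polyC (invmx P) *m ('X%:M - map_mx polyC A) *m map_mx polyC P.
  rewrite mulmxBr mulmxBl !map_mxM; congr (_ - _).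
  by rewrite mul_mx_scalar -scalemxAl PP scalemx1.
by rewrite !det_mulmx mulrAC -det_mulmx PP det1 mul1r.
Qed.

(** The matrix becomes Hermitian over the complex numbers, where the spectral theorem diagonalizes
    it with real eigenvalues; the conclusions descend because the embedding is injective. *)
Lemma symmetric_char_poly (R : rcfType) n (A : 'M[R]_n) : A^T = A ->
  exists d : 'rV[R]_n, [/\ char_poly A = \prod_i ('X - (d 0 i)%:P),
    \tr A = \sum_i d 0 i & d = 0 -> A = 0].
Proof.
move=> As.
pose toC := GRing.RMorphism.clone _ _ (real_complex R) _.
pose Ac := map_mx toC A.
have Ah : Ac \is hermsymmx.
  apply: realsym_hermsym.
    by apply/is_hermitianmxP; rewrite expr0 scale1r map_mx_id //; rewrite map_trmx As.
  by apply/mxOverP => i j; rewrite mxE complex_real.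
have /mxOverP dr := hermitian_spectral_diag_real Ah.
have /hermitian_normalmx/orthomx_spectralP AE := Ah.
have Pu := spectral_unit Ac.
set P := spectralmx Ac in AE Pu; set D := spectral_diag Ac in AE dr.
pose d : 'rV[R]_n := \row_i complex.Re (D 0 i).
have dE i : toC (d 0 i) = D 0 i.
  by rewrite mxE; have /complex_realP[k ->] := dr 0 i.
exists d; split.
- apply: (map_poly_inj toC); rewrite map_char_poly -/Ac AE char_poly_conj //.
  rewrite char_poly_trig ?diag_mx_is_trig //.
  rewrite rmorph_prod; apply: eq_bigr => i _ /=.
  by rewrite rmorphB /= map_polyX map_polyC /= -/(toC _) dE mxE eqxx.
- apply: (fmorph_inj toC); rewrite -trace_map_mx -/Ac AE mxtrace_mulC mulmxA mulmxV // mul1mx.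
  by rewrite mxtrace_diag rmorph_sum; apply: eq_bigr => i _; rewrite dE.
- move=> d0; apply: (@map_mx_inj _ _ toC).
  have D0 : D = 0 by apply/rowP => i; rewrite -dE d0 !mxE.
  by rewrite -/Ac AE D0 (_ : diag_mx 0 = 0) ?mulmx0 ?mul0mx ?map_mx0 ?raddf0.
Qed.

(** Induction on the size: [L] clears the first row and column of [G], and the induction hypothesis
    treats what remains. *)
Lemma posdef_orthonormal_frame (R : rcfType) n (G : 'M[R]_n) : G^T = G ->
  (forall v : 'rV_n, v != 0 -> 0 < (v *m G *m v^T) 0 0) ->
  exists E : 'M[R]_n, E *m G *m E^T = 1%:M.
Proof.
elim: n G => [|n IHn] G; first by exists 0; apply/matrixP => -[].
rewrite -[n.+1]/(1 + n)%N in G * => Gs Gp.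
pose a := G 0 0; pose b := ursubmx G.
have ulG : ulsubmx G = a%:M.
  by apply/matrixP => i j; rewrite !ord1 !mxE eqxx /a; congr (G _ _); apply/val_inj.
have dlG : dlsubmx G = b^T by rewrite /b trmx_ursub Gs.
have GE : G = block_mx a%:M b b^T (drsubmx G) by rewrite -ulG -dlG submxK.
have a0 : 0 < a.
  have := Gp (delta_mx 0 0); rewrite -rowE mxE.
  have -> : (delta_mx 0 0 : 'rV[R]_(1 + n)) != 0.
    by apply/eqP => /matrixP/(_ 0 0)/eqP; rewrite !mxE oner_eq0.
  move=> /(_ isT); rewrite (bigD1 0) //= big1 => [|j j0]; last by rewrite !mxE (negbTE j0) mulr0.
  by rewrite !mxE mulr1 addr0.
have an0 : a != 0 by rewrite gt_eqF.
pose L : 'M[R]_(1 + n) := block_mx 1%:M 0 (- a^-1 *: b^T) 1%:M.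
(* The Schur complement of the corner entry [a]. *)
pose C := drsubmx G - a^-1 *: (b^T *m b).
have LG : L *m G *m L^T = block_mx a%:M 0 0 C.
  rewrite GE /L tr_block_mx !mulmx_block !trmx1 !trmx0 linearZ /= trmxK.
  rewrite !(mul1mx, mul0mx, mulmx0, mulmx1, addr0, add0r).
  rewrite mul_mx_scalar scalerA mulrN mulfV // scaleN1r addNr mul0mx add0r.
  rewrite mul_scalar_mx scalerA mulrN mulfV // scaleN1r addNr.
  by rewrite -scalemxAl scaleNr addrC.
have Lu : L \in unitmx by rewrite unitmxE /L det_lblock !det1 mulr1 unitr1.
have [|w w0|E' E'1] := IHn C.
- have : (L *m G *m L^T)^T = L *m G *m L^T by rewrite !trmx_mul trmxK Gs mulmxA.
  by rewrite LG tr_block_mx => /eq_block_mx[_ _ _].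
(* Evaluating [G] on (0, w) L gives [C] on [w], so [C] inherits positivity; the vector is nonzero
   since [L] is invertible. *)
- have v0 : row_mx (0 : 'M[R]_1) w *m L != 0.
    apply: contra w0 => /eqP/(congr1 (mulmx^~ (invmx L))).
    by rewrite mulmxK // mul0mx -[in RHS]row_mx0 => /eq_row_mx[_ ->].
  have := Gp _ v0.
  rewrite trmx_mul !mulmxA -2!(mulmxA (row_mx _ _)) LG mul_row_block tr_row_mx mul_row_col.
  by rewrite !(mul0mx, mulmx0, add0r, trmx0).
exists (block_mx (Num.sqrt a)^-1%:M 0 0 E' *m L).
rewrite trmx_mul !mulmxA -2!(mulmxA (block_mx _ _ _ _)) LG tr_block_mx !mulmx_block.
rewrite !(mul1mx, mul0mx, mulmx0, mulmx1, addr0, add0r, trmx0) E'1.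
rewrite tr_scalar_mx -!scalar_mxM mulrAC -invfM -expr2 sqr_sqrtr ?ltW // mulVf //.
by rewrite -scalar_mx_block.
Qed.

(** * Bivector indices and sorted eigenvalues *)

Lemma card_wedge_idx n :
  #|{: {ab : 'I_n * 'I_n | (ab.1 < ab.2)%N}}| = (n * n.-1)./2.
Proof.
rewrite card_sig -bin2 -bin2_sum.
rewrite -sum1_card (eq_bigl (fun ab : 'I_n * 'I_n => (ab.1 < ab.2)%N)) //.
rewrite -(pair_big_dep xpredT (fun a b : 'I_n => (a < b)%N) (fun _ _ => 1%N)) /=.
(* Grouped by the larger index [b], there are [b] choices for the smaller one. *)
rewrite (exchange_big_dep xpredT) //= big_mkord; apply: eq_bigr => b _.
by rewrite -(big_ord_widen n (fun=> 1%N) (ltnW (ltn_ord b))) sum1_card card_ord.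
Qed.

Lemma big_wedge_idx (R : pzRingType) n (F : 'I_n * 'I_n -> R) :
  \sum_(s < #|{: {ab : 'I_n * 'I_n | (ab.1 < ab.2)%N}}|) F (val (enum_val s)) =
  \sum_(ab : 'I_n * 'I_n | (ab.1 < ab.2)%N) F ab.
Proof.
rewrite (reindex (@enum_rank _)) /=; last exact/onW_bij/enum_rank_bij.
under eq_bigr do rewrite enum_rankK.
rewrite [RHS](reindex_omap (val : {ab : 'I_n * 'I_n | (ab.1 < ab.2)%N} -> _) insub) /=.
  by apply: eq_bigl => -[ab abP] /=; rewrite insubT /= eqxx abP.
by move=> ab abP; rewrite insubT.
Qed.

(** Invariance of all commutative big operators encodes that [mu] is a rearrangement of [d]; it
    serves the characteristic polynomial, the trace and the sum of squares alike. The equation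
    between [N'] and [N] bridges the two index types. *)
Lemma sorted_enumeration (R : realDomainType) N N' (d : 'I_N' -> R) : N' = N ->
  exists mu : 'I_N -> R, (forall a b : 'I_N, (a <= b)%N -> mu a <= mu b) /\
    forall (T : Type) (idx : T) (op : Monoid.com_law idx) (F : R -> T),
      \big[op/idx]_i F (d i) = \big[op/idx]_a F (mu a).
Proof.
move=> NN'.
pose s := sort <=%R [seq d i | i <- enum 'I_N'].
have ss : size s = N by rewrite size_sort size_map size_enum_ord.
have ps : perm_eq s [seq d i | i <- enum 'I_N'] by rewrite perm_sort.
exists (fun a => s`_a); split.
  move=> a b ab; apply: (sorted_leq_nth le_trans le_refl) => //; rewrite ?inE ?ss //.
  exact: sort_le_sorted.
move=> T idx op F.
rewrite -(big_mkord xpredT (fun i => F s`_i)) -ss -(big_nth 0 xpredT F).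
by rewrite (perm_big _ ps) big_map big_enum.
Qed.

Lemma sum_ge0_of_two_smallest (R : realFieldType) N (mu : 'I_N -> R) (l L : R) :
  (3 <= N)%N -> (forall a b : 'I_N, (a <= b)%N -> mu a <= mu b) -> 0 < L <= l ->
  (forall a b : 'I_N, (a < b)%N -> 0 <= l * mu a + L * mu b) ->
  0 <= \sum_a mu a /\ (\sum_a mu a = 0 -> forall a, mu a = 0).
Proof.
(* Indices start at 0: [o0], [o1], [o2] carry mu_1, mu_2, mu_3. *)
case: N mu => [|[|[|N]]] // mu _ mm /andP[L0 Ll] h.
pose o0 : 'I_N.+3 := ord0; pose o1 : 'I_N.+3 := lift ord0 ord0.
pose o2 : 'I_N.+3 := lift ord0 (lift ord0 ord0).
have h01 := h o0 o1 isT.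
have m01 := mm o0 o1 isT.
have m12 := mm o1 o2 isT.
(* Otherwise [mu o0] and [mu o1] are both negative, while [l] and [L] are positive. *)
have mu1 : 0 <= mu o1.
  rewrite leNgt; apply/negP => mu1; move: h01; apply/negP; rewrite -ltNge; nra.
(* As [mu o1] is nonnegative and [L <= l], the hypothesis bounds [l * (mu o0 + mu o1)] below by
   0. *)
have mu01 : 0 <= mu o0 + mu o1.
  rewrite leNgt; apply/negP => mu01; move: h01; apply/negP; rewrite -ltNge; nra.
have rest : 0 <= \sum_(i < N) mu (lift ord0 (lift ord0 (lift ord0 i))).
  by apply: sumr_ge0 => i _; rewrite (le_trans mu1) // mm.
have SE : \sum_a mu a = mu o0 + (mu o1 + (mu o2 + \sum_(i < N) mu (lift ord0 (lift ord0 (lift ord0 i))))).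
  by rewrite !big_ord_recl.
split; first by rewrite SE; lra.
(* A zero sum forces [mu o2], hence [mu o1], to vanish, and then [mu o0] is nonnegative. *)
move=> S0 a; have mu0 : 0 <= mu o0 by rewrite SE in S0; lra.
have mup i : true -> 0 <= mu i by move=> _; rewrite (le_trans mu0) // mm.
exact: (psumr_eq0P mup S0).
Qed.

(** * Expansions and traces in an orthonormal frame *)

Section Frame.
Variables (R : realType) (n : nat) (G E : 'M[R]_n).
Hypothesis EG : E *m G *m E^T = 1%:M.

Lemma frame_unit : E \in unitmx.
Proof. by have [] := mulmx1_unit (etrans (mulmxA _ _ _) EG). Qed.

Lemma frame_vanish (f : 'rV[R]_n -> R) : scalar f ->
  (forall a, f (row a E) = 0) -> forall u, f u = 0.
Proof.
move=> fL f0 u; rewrite -(mulmxKV frame_unit u) mulmx_sum_row.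
have fz := scalar0 fL.
elim/big_ind: _ => // [a b fa fb|i _].
  by rewrite -[a]scale1r fL fa fb mulr0 addr0.
by rewrite -[_ *: _]addr0 fL f0 fz mulr0 addr0.
Qed.

Lemma frame_mulV : G *m (E^T *m E) = 1%:M.
Proof. by apply: (can_inj (mulKmx frame_unit)); rewrite !mulmxA EG mul1mx mulmx1. Qed.

Lemma invmx_frame : invmx G = E^T *m E.
Proof.
have [Gu _] := mulmx1_unit frame_mulV.
by apply: (can_inj (mulKmx Gu)); rewrite mulmxV // frame_mulV.
Qed.

Lemma frame_coord (r : 'rV[R]_n) i :
  r 0 i = \sum_a E a i * (r *m G *m (row a E)^T) 0 0.
Proof.
have {1}-> : r = r *m G *m E^T *m E by rewrite -!mulmxA frame_mulV mulmx1.
rewrite mxE; apply: eq_bigr => a _; rewrite mulrC; congr (_ * _).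
by rewrite !mxE; apply: eq_bigr => j _; rewrite !mxE.
Qed.

(** Since the inverse of [G] is [E^T *m E], the coordinate contraction is the trace over the
    frame. *)
Lemma contract_frame (T : 'rV[R]_n -> 'rV[R]_n -> R) :
  (forall v, scalar (T^~ v)) -> (forall u, scalar (T u)) ->
  \sum_j \sum_k invmx G j k * T (coord_vec j) (coord_vec k) =
  \sum_b T (row b E) (row b E).
Proof.
move=> T1 T2; rewrite invmx_frame.
under [RHS]eq_bigr => b _.
  rewrite (scalar_expand (T1 _)).
  under eq_bigr => j _ do rewrite (scalar_expand (T2 _)) mulr_sumr.
  over.
rewrite [RHS]exchange_big /=; apply: eq_bigr => j _.
rewrite [RHS]exchange_big /=; apply: eq_bigr => k _.
rewrite mxE mulr_suml; apply: eq_bigr => b _; rewrite !mxE; ring.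
Qed.

End Frame.

Lemma sum_offdiag (R : pzRingType) n (F : 'I_n -> 'I_n -> R) :
  (forall a b, F a b = F b a) -> (forall a, F a a = 0) ->
  \sum_b \sum_a F a b = \sum_(ab : 'I_n * 'I_n | (ab.1 < ab.2)%N) 2 * F ab.1 ab.2.
Proof.
move=> Fs F0.
have lt_sum : \sum_(ab : 'I_n * 'I_n | (ab.1 < ab.2)%N) F ab.1 ab.2 =
    \sum_(a < n) \sum_(b < n | (a < b)%N) F a b.
  by rewrite (pair_big_dep xpredT (fun a b : 'I_n => (a < b)%N) F).
rewrite -mulr_sumr lt_sum mulr_natl mulr2n [X in _ = _ + X](exchange_big_dep xpredT) //= -big_split /=.
apply: eq_bigr => b _; rewrite [LHS](bigID (fun a : 'I_n => (b < a)%N)) /=.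
congr (_ + _); first by apply: eq_bigr => a _; exact: Fs.
rewrite (bigD1 b) ?ltnn //= F0 add0r; apply: eq_bigl => a.
by rewrite -leqNgt andbC -val_eqE ltn_neqAle.
Qed.

(** * The curvature operator at a point *)

Section CurvatureAtPoint.
Variables (R : realType) (n : nat) (M : topologicalType).
Variables (S : smooth_manifold R n M) (g : riemannian_metric S) (p : M).
Implicit Types u v w z : 'rV[R]_n.

Let i0 := chart_at S p.
Let x0 := phi S i0 p.
Let U : set 'rV[R]_n := (phi S i0 @` dom S i0)%classic.

Let Ux0 : U x0.
Proof. by exists p => //; exact: dom_chart_at. Qed.

Let Uo : open U := @cod_open R n M S i0.
Let Gs := @metric_smooth R n M S g i0.
Let GT := @metric_symmetric R n M S g i0.
Let Gp := @metric_pos R n M S g i0.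

Definition curv u v w z : R := inner g p (Rm g p u v w) z.

Lemma curv_antisym12 u v w z : curv u v w z = - curv v u w z.
Proof. exact: (riem_antisym12 Uo Gs GT Gp u v w z Ux0). Qed.

Lemma curv_antisym34 u v w z : curv u v w z = - curv u v z w.
Proof. exact: (riem_antisym34 Uo Gs GT Gp u v w z Ux0). Qed.

Lemma curv_pair u v w z : curv u v w z = curv w z u v.
Proof. exact: (riem_pair Uo Gs GT Gp u v w z Ux0). Qed.

Lemma curv_scalar1 v w z : scalar (fun u => curv u v w z).
Proof. exact: (riem_scalar1 Uo Gs GT Gp v w z Ux0). Qed.

Lemma curv_scalar2 u w z : scalar (fun v => curv u v w z).
Proof. exact: (riem_scalar2 Uo Gs GT Gp u w z Ux0). Qed.

Lemma curv_scalar3 u v z : scalar (fun w => curv u v w z).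
Proof. exact: (riem_scalar3 Uo Gs GT Gp u v z Ux0). Qed.

Lemma curv_scalar4 u v w : scalar (curv u v w).
Proof. exact: (riem_scalar4 GT u v w Ux0). Qed.

Lemma metric_at_frame : exists E : 'M[R]_n, E *m metric_at g p *m E^T = 1%:M.
Proof. by apply: posdef_orthonormal_frame; [exact: GT|exact: Gp]. Qed.

Lemma curvopE u v z w : curvop g p u v z w = 2 * curv u v w z.
Proof. by []. Qed.

Lemma curv_form u v w z : (Rm g p u v w *m metric_at g p *m z^T) 0 0 = curv u v w z.
Proof. by []. Qed.

Local Opaque curv curvop.

Variable E : 'M[R]_n.
Hypothesis EG : E *m metric_at g p *m E^T = 1%:M.

Lemma frame_orthonormal : orthonormal_frame g p E.
Proof.
move=> a b; transitivity ((E *m metric_at g p *m E^T) a b); last by rewrite EG mxE.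
by rewrite /inner -row_mul mxE [RHS]mxE; apply: eq_bigr => j _; congr (_ * _); rewrite !mxE.
Qed.

(** [curvop] exchanges its last two arguments, so pair symmetry leaves both pairs reversed; two
    antisymmetries restore them and their signs cancel. *)
Lemma curvop_mx_sym : (curvop_mx g p E)^T = curvop_mx g p E.
Proof.
by apply/matrixP => s t; rewrite !mxE /= !curvopE curv_pair curv_antisym12 curv_antisym34 opprK.
Qed.

(** The matrix records only increasing index pairs; antisymmetry supplies the others, and
    multilinearity passes from the frame to all vectors. *)
Lemma curv_eq0_frame : curvop_mx g p E = 0 -> forall u v w z, curv u v w z = 0.
Proof.
move=> C0.
have c0 (a b c d : 'I_n) : (a < b)%N -> (c < d)%N -> curv (row a E) (row b E) (row d E) (row c E) = 0.
  move=> ab cd; pose I := {ab : 'I_n * 'I_n | (ab.1 < ab.2)%N}.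
  move/matrixP: C0 => /(_ (enum_rank (Sub (a, b) ab : I)) (enum_rank (Sub (c, d) cd : I))).
  rewrite !mxE !enum_rankK /= curvopE => /eqP.
  by rewrite mulf_eq0 pnatr_eq0 /= => /eqP.
have same u v w : curv u u v w = 0.
  by have := curv_antisym12 u u v w; lra.
have same34 u v w : curv u v w w = 0.
  by have := curv_antisym34 u v w w; lra.
have c1 (a b c d : 'I_n) : (a < b)%N -> curv (row a E) (row b E) (row c E) (row d E) = 0.
  move=> ab; case: (ltngtP c d) => [cd|dc|/val_inj ->] //.
    by rewrite curv_antisym34 c0 // oppr0.
  exact: c0.
have c2 (a b c d : 'I_n) : curv (row a E) (row b E) (row c E) (row d E) = 0.
  case: (ltngtP a b) => [ab|ba|/val_inj ->].
  - exact: c1.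
  - by rewrite curv_antisym12 c1 // oppr0.
  - exact: same.
move=> u v w z.
apply: (frame_vanish EG (curv_scalar1 v w z)) => a.
apply: (frame_vanish EG (curv_scalar2 (row a E) w z)) => b.
apply: (frame_vanish EG (curv_scalar3 (row a E) (row b E) z)) => c.
by apply: (frame_vanish EG (curv_scalar4 (row a E) (row b E) (row c E))) => d.
Qed.

(** Each coordinate of Rm is expanded in the frame; summing over [i] then reassembles the frame
    vector in the first slot. *)
Lemma Ric_frame v w : Ric g p v w = \sum_a curv (row a E) v w (row a E).
Proof.
rewrite /Ric; under eq_bigr => i _ do rewrite (frame_coord EG).
rewrite exchange_big /=; apply: eq_bigr => a _.
rewrite (scalar_expand (curv_scalar1 v w (row a E))); apply: eq_bigr => i _.
by rewrite curv_form [in RHS]mxE.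
Qed.

Lemma Scal_frame : Scal g p = \sum_b \sum_a curv (row a E) (row b E) (row b E) (row a E).
Proof.
rewrite /Scal (contract_frame EG (T := Ric g p)).
- by apply: eq_bigr => b _; rewrite Ric_frame.
- move=> w c u v; rewrite !Ric_frame mulr_sumr -big_split /=.
  by apply: eq_bigr => a _; rewrite (curv_scalar2 (row a E) w (row a E)).
- move=> v c w w'; rewrite !Ric_frame mulr_sumr -big_split /=.
  by apply: eq_bigr => a _; rewrite (curv_scalar3 (row a E) v (row a E)).
Qed.

(** The factor 2 in [curvop] accounts for the two orders of each index pair in the double sum. *)
Lemma Scal_trace : Scal g p = \tr (curvop_mx g p E).
Proof.
rewrite Scal_frame sum_offdiag; last 2 first.
- by move=> a b; rewrite curv_antisym12 curv_antisym34 opprK.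
- by move=> a; have := curv_antisym12 (row a E) (row a E) (row a E) (row a E); lra.
rewrite -(big_wedge_idx (fun ab => 2 * curv (row ab.1 E) (row ab.2 E) (row ab.2 E) (row ab.1 E))).
by apply: eq_bigr => s _; rewrite mxE /= curvopE.
Qed.

End CurvatureAtPoint.

(** * Sign of the scalar curvature and the case of equality *)

Theorem theorem4p1 (R : realType) (n : nat) (hn : (3 <= n)%N)
    (M : topologicalType) (S : smooth_manifold R n M) (g : riemannian_metric S)
    (l1 l2 : R) (hl : in_Lambda l1 l2) (hR : lambda_nonnegative g l1 l2) :
  forall p : M, 0 <= Scal g p /\ (Scal g p = 0 <-> curvop_zero g p).
Proof.
move=> p; have [E EG] := metric_at_frame g p.
have [d [dchar dtr d0]] := symmetric_char_poly (curvop_mx_sym g p E).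
have [mu [mu_mono muF]] := sorted_enumeration (fun i => d 0 i) (card_wedge_idx n).
have mu_eig : curvop_eigenvalues g p mu.
  split=> //; exists E; split; first exact: frame_orthonormal.
  by rewrite dchar; exact: (muF _ _ _ (fun c => 'X - c%:P)).
have ScalE : Scal g p = \sum_a mu a.
  by rewrite (Scal_trace EG) dtr; exact: (muF _ _ _ id).
have [_ h2] := hR p mu mu_eig.
(* The number of eigenvalues is a binomial coefficient, monotone in [n], with value 3 at [n = 3]. *)
have N3 : (3 <= (n * n.-1)./2)%N.
  by rewrite -bin2 -[3%N]/('C(3, 2)); apply: leq_bin2l.
have [_ _ _ L] := hl.
have [S0 Z0] := sum_ge0_of_two_smallest N3 mu_mono L h2.
split; first by rewrite ScalE.
rewrite ScalE; split=> [/Z0 mu0 | c0].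
  have dz : d = 0.
    apply/rowP => i; rewrite mxE.
    (* The rearrangement is known only through big operators, so a sum of squares carries the
       vanishing from [mu] to [d]. *)
    have sq : \sum_i d 0 i ^+ 2 = \sum_a mu a ^+ 2 by exact: (muF _ _ _ (fun c => c ^+ 2)).
    rewrite [RHS]big1 in sq => [|a _]; last by rewrite mu0 expr0n.
    have sq_ge0 j : true -> 0 <= d 0 j ^+ 2 by move=> _; exact: sqr_ge0.
    have /eqP : d 0 i ^+ 2 = 0 by exact: (psumr_eq0P sq_ge0 sq).
    by rewrite sqrf_eq0 => /eqP.
  by move=> x y z w; rewrite curvopE (curv_eq0_frame EG) ?mulr0 // d0.
rewrite -ScalE (Scal_trace EG) (_ : curvop_mx g p E = 0) ?mxtrace0 //.
by apply/matrixP => s t; rewrite !mxE; exact: c0.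
Qed.
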